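(* Let $k$ be a field, let $d\geq 2$, and let $V_d$ be a $d$-dimensional $k$-vector space. Then there exists a nontrivial (i.e. nonzero) linear map $det^{S^2}:V_d^{\otimes d(2d-1)}\to k$ with the property that $det^{S^2}(\otimes_{1\leq i<j\leq 2d}(v_{i,j}))=0$ whenever there exist $1\leq x<y<z\leq 2d$ such that $v_{x,y}=v_{x,z}=v_{y,z}$.
   Context: $V_d^{\otimes m}$ denotes the $m$-th tensor power of $V_d$ over $k$. The $d(2d-1)$ tensor factors of $V_d^{\otimes d(2d-1)}$ are indexed by the pairs $(i,j)$ with $1\leq i<j\leq 2d$, and $\otimes_{1\leq i<j\leq 2d}(v_{i,j})$ denotes the simple tensor with entry $v_{i,j}\in V_d$ in the factor indexed by $(i,j)$. *)

(* Defs.v *)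
From HB Require Import structures.
From mathcomp Require Import all_boot all_order all_algebra.
From mathcomp Require Import finmap boolp monalg.
Set Implicit Arguments. Unset Strict Implicit. Unset Printing Implicit Defensive.
Import GRing.Theory.
Local Open Scope ring_scope.
Local Open Scope quotient_scope.

Definition update (I : finType) (T : Type) (v : I -> T) (i : I) (x : T) : I -> T :=
  fun j => if j == i then x else v j.

Definition multilinear (K : fieldType) (I : finType) (V W : lmodType K)
    (f : (I -> V) -> W) : Prop :=
  forall (v : I -> V) (i : I) (a : K) (x y : V),
    f (update v i (a *: x + y)) = a *: f (update v i x) + f (update v i y).

(* The tensor power of V with factors indexed by the finite type I: the free
   K-module on the families v : I -> V (the formal linear combinations
   {malg K[{ffun I -> V}]}, of which only the module structure is used), modulo
   the submodule generated by the multilinearity relations. *)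
Section TensorPower.
Variables (K : fieldType) (I : finType) (V : lmodType K).

Local Notation free := {malg K[{ffun I -> V}]}.

Definition free_gen (v : I -> V) : free := << 1 *g [ffun i => v i] >>.

Definition multilinear_relation (v : I -> V) (i : I) (a : K) (x y : V) : free :=
  free_gen (update v i (a *: x + y))
    - (a *: free_gen (update v i x) + free_gen (update v i y)).

Definition in_relations : {pred free} := fun t =>
  `[< forall P : {pred free}, submod_closed P ->
        (forall v i a x y, multilinear_relation v i a x y \in P) ->
        t \in P >].

Fact in_relationsP (t : free) :
  reflect (forall P : {pred free}, submod_closed P ->
             (forall v i a x y, multilinear_relation v i a x y \in P) ->
             t \in P) (t \in in_relations).
Proof. exact: asboolP. Qed.

Fact relations_submod_closed : submod_closed in_relations.
Proof.
split=> [|a u v /in_relationsP Hu /in_relationsP Hv].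
  by apply/in_relationsP => P [].
apply/in_relationsP => P cP gP; case: (cP) => _; apply; [exact: Hu | exact: Hv].
Qed.

HB.instance Definition _ :=
  GRing.isSubmodClosed.Build K free in_relations relations_submod_closed.

Definition tensor_power := Quotient.quot (in_relations : zmodClosed free).
HB.instance Definition _ := Choice.on tensor_power.
HB.instance Definition _ := GRing.Zmodule.on tensor_power.
HB.instance Definition _ := EqQuotient.on tensor_power.

Local Notation pi := (\pi_tensor_power : free -> tensor_power).

Fact tensor_power_eqP (s t : free) :
  reflect (pi s = pi t) (s - t \in in_relations).
Proof. by rewrite Quotient.idealrBE; apply: eqP. Qed.

Definition tensor_scale (a : K) (t : tensor_power) : tensor_power :=
  pi (a *: repr t).

Fact pi_scale (a : K) (s : free) : tensor_scale a (pi s) = pi (a *: s).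
Proof.
apply/tensor_power_eqP; rewrite -scalerBr rpredZ //.
by apply/tensor_power_eqP; rewrite reprK.
Qed.

Fact pi_add (s t : free) : pi s + pi t = pi (s + t).
Proof. by rewrite [RHS]raddfD. Qed.

Fact tensor_scaleA a b t :
  tensor_scale a (tensor_scale b t) = tensor_scale (a * b) t.
Proof. by elim/quotW: t => t; rewrite (pi_scale b t) !pi_scale scalerA. Qed.

Fact tensor_scale1 : left_id 1 tensor_scale.
Proof. by elim/quotW => t; rewrite pi_scale scale1r. Qed.

Fact tensor_scaleDr : right_distributive tensor_scale +%R.
Proof.
move=> a; elim/quotW => s; elim/quotW => t; rewrite pi_add !pi_scale pi_add.
by rewrite scalerDr.
Qed.

Fact tensor_scaleDl t : {morph tensor_scale^~ t : a b / a + b}.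
Proof. by move=> a b; elim/quotW: t => t; rewrite !pi_scale pi_add scalerDl. Qed.

HB.instance Definition _ := GRing.Zmodule_isLmodule.Build K tensor_power
  tensor_scaleA tensor_scale1 tensor_scaleDr tensor_scaleDl.

Fact pi_scaleE (a : K) (s : free) : a *: pi s = pi (a *: s).
Proof. exact: pi_scale. Qed.

Definition tensor (v : I -> V) : tensor_power := pi (free_gen v).

End TensorPower.

Arguments tensor_power {K} I V.

Lemma tensor_multilinear (K : fieldType) (I : finType) (V : lmodType K) :
  multilinear (@tensor K I V).
Proof.
move=> v i a x y; rewrite /tensor pi_scaleE pi_add.
by apply/tensor_power_eqP/in_relationsP => P _; apply.
Qed.

Section UniversalProperty.
Variables (K : fieldType) (I : finType) (V W : lmodType K) (f : (I -> V) -> W).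

Local Notation free := {malg K[{ffun I -> V}]}.

Definition free_lift (t : free) : W :=
  \sum_(v <- msupp t) t@_v *: f v.

Fact free_liftEw (t : free) (D : {fset {ffun I -> V}}) :
  (msupp t `<=` D)%fset -> free_lift t = \sum_(v <- D) t@_v *: f v.
Proof.
move=> sD; rewrite /free_lift; apply: big_fset_incl => // v _.
by rewrite -mcoeff_eq0 => /eqP ->; rewrite scale0r.
Qed.

Fact free_lift_linear : linear free_lift.
Proof.
move=> a s t; pose D := (msupp s `|` msupp t)%fset.
have sD : (msupp s `<=` D)%fset by apply: fsubsetUl.
have tD : (msupp t `<=` D)%fset by apply: fsubsetUr.
have asD := fsubset_trans (msuppZ_le a s) sD.
have dD : (msupp (a *: s + t) `<=` D)%fset.
  by apply: fsubset_trans (msuppD_le _ _) _; rewrite fsubUset asD.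
rewrite (free_liftEw sD) (free_liftEw tD) (free_liftEw dD) scaler_sumr -big_split /=.
by apply: eq_bigr => v _; rewrite mcoeffD mcoeffZ scalerDl scalerA.
Qed.

HB.instance Definition _ := GRing.isLinear.Build K free W _ free_lift free_lift_linear.

Fact free_lift_gen (v : I -> V) : free_lift (free_gen v) = f v.
Proof.
rewrite (free_liftEw msuppU_le) big_seq_fset1 mcoeffUU scale1r.
by congr f; apply/funext => i; rewrite ffunE.
Qed.

Hypothesis f_multilinear : multilinear f.

Fact free_lift_relations (t : free) : t \in @in_relations K I V -> free_lift t = 0.
Proof.
move=> /in_relationsP/(_ [pred t | free_lift t == 0]) /= H.
apply/eqP; apply: H => [|v i a x y]; last first.
  rewrite inE /multilinear_relation linearB linearD linearZ /= !free_lift_gen.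
  by rewrite f_multilinear subrr.
split=> [|a s u]; rewrite !inE ?linear0 // => /eqP s0 /eqP u0.
by rewrite linearP /= s0 u0 scaler0 addr0.
Qed.

Definition tensor_lift (t : tensor_power I V) : W := free_lift (repr t).

Fact tensor_lift_pi (s : free) :
  tensor_lift (\pi_(tensor_power I V) s) = free_lift s.
Proof.
apply/eqP; rewrite -subr_eq0 -linearB; apply/eqP/free_lift_relations.
by apply/tensor_power_eqP; rewrite reprK.
Qed.

Fact tensor_lift_linear : linear tensor_lift.
Proof.
move=> a; elim/quotW => s; elim/quotW => t; rewrite pi_scaleE pi_add.
by rewrite !tensor_lift_pi linearP.
Qed.

End UniversalProperty.

Lemma tensor_ext (K : fieldType) (I : finType) (V W : lmodType K)
    (g h : {linear tensor_power I V -> W}) :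
  (forall v, g (tensor v) = h (tensor v)) -> g =1 h.
Proof.
move=> gh; elim/quotW => t.
rewrite [t]monalgE raddf_sum !raddf_sum /=; apply: eq_bigr => v _.
have -> : \pi_(tensor_power I V) << t@_v *g v >> = t@_v *: tensor v.
  rewrite /tensor pi_scaleE; congr (\pi _); apply/malgP => w.
  rewrite mcoeffZ !mcoeffU; have -> : [ffun i => v i] = v by apply/ffunP => i; rewrite ffunE.
  by rewrite mulr_natr.
by rewrite !linearZ gh.
Qed.

Theorem tensor_universal (K : fieldType) (I : finType) (V W : lmodType K)
    (f : (I -> V) -> W) :
  multilinear f ->
  exists2 g : {linear tensor_power I V -> W},
    (forall v, g (tensor v) = f v) &
    forall h : {linear tensor_power I V -> W},
      (forall v, h (tensor v) = f v) -> h =1 g.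
Proof.
move=> fM.
pose m := GRing.isLinear.Build K (tensor_power I V) W _ _ (tensor_lift_linear fM).
pose g : {linear tensor_power I V -> W} := HB.pack (tensor_lift f) m.
have gE v : g (tensor v) = f v by rewrite /= tensor_lift_pi // free_lift_gen.
exists g => // h hE; apply: tensor_ext => v.
by rewrite hE gE.
Qed.

(* Indices run over 0, ..., n - 1 instead of 1, ..., n. *)
Definition ordered_pair (n : nat) : finType :=
  {p : 'I_n * 'I_n | (p.1 < p.2)%N}.

Definition mk_pair (n : nat) (x y : 'I_n) (lt_xy : (x < y)%N) : ordered_pair n :=
  exist (fun p : 'I_n * 'I_n => (p.1 < p.2)%N) (x, y) lt_xy.

Lemma card_ordered_pair (d : nat) : #|ordered_pair (2 * d)| = (d * (2 * d - 1))%N.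
Proof.
rewrite card_sig -sum1_card.
rewrite -(pair_big_dep xpredT (fun x y : 'I_(2 * d) => (x < y)%N) (fun _ _ => 1%N)) /=.
rewrite (exchange_big_dep xpredT) //=.
transitivity (\sum_(j < 2 * d) j)%N.
  apply: eq_bigr => j _.
  by rewrite (big_ord_narrow (ltnW (ltn_ord j))) sum1_card card_ord.
rewrite -(big_mkord xpredT id) /= bin2_sum bin2 mul2n subn1.
by rewrite -doubleMl doubleK.
Qed.

(* Main.v *)
Require Import Defs.
From mathcomp Require Import all_boot all_order all_algebra.
Import GRing.Theory VectorInternalTheory.
Local Open Scope ring_scope.

(** Write d for the dimension of V. A family v of vectors indexed by the edges
    (i, j), i < j, of the complete graph on 2d vertices gives a linear system in
    unknowns l_(i,j): at every vertex, the sum of the l_(i,j) v_(i,j) over the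
    incident edges, signed by orientation, has to vanish in V. The equations of
    all the vertices add up to 0, so the last vertex may be dropped. What is
    left is d(2d - 1) scalar equations in d(2d - 1) unknowns, and detS2 is the
    determinant of this square system. Here its transpose is used: there is one
    row per edge, the flattening of the rank one matrix (v_e)^T (p_i - p_j),
    where p_i is the i-th unit vector and p_(2d - 1) = 0.

    Each row is linear in v_e, so the determinant is multilinear
    ([edge_det_multilinear]) and factors through the tensor power. If v takes
    the same value on the three edges of a triangle, the signed sum of their
    rows telescopes to 0 and the determinant vanishes ([edge_det_triangle]).

    The determinant is nonzero because the edges of the complete graph can be
    divided into d spanning trees ([double_star_connected]): let v be the c-th
    basis vector on all edges of the c-th tree. A vector in the kernel of the
    system's transpose assigns to each c a potential on the vertices which is 0
    at the last vertex and has equal values at the ends of every edge of the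
    c-th tree. Such a potential is 0 since the tree is connected
    ([edge_det_neq0]). *)

(** * A decomposition of the complete graph into spanning trees *)

(** Pair the vertices as {2a, 2a + 1}. Tree a is a double star with centers 2a
    and 2a + 1: besides the edge joining the centers, it links each vertex of a
    later pair to the center of the same parity, and each vertex of an earlier
    pair to the center of the other parity. So of the four edges between two
    pairs, each of the two trees gets a perfect matching. As i < j, the formula
    also covers the edge from 2a to 2a + 1. *)
Definition edge_tree (i j : nat) : nat :=
  if odd i == odd j then i./2 else j./2.

Lemma double_star_connected (T : Type) (n c : nat) (g : nat -> T) :
    (c < n)%N ->
    (forall i j, (i < j)%N -> (j < 2 * n)%N -> edge_tree i j = c -> g i = g j) ->
  forall i, (i < 2 * n)%N -> g i = g c.*2.
Proof.
rewrite mul2n => ltcn edge_eq.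
have centers : g c.*2 = g c.*2.+1.
  apply: edge_eq; rewrite ?ltn_Sdouble //.
  by rewrite /edge_tree /= odd_double /= uphalf_double.
(* A boolean b, read as 0 or 1, selects the center of parity b. *)
have center (b : bool) : g (b + c.*2)%N = g c.*2 by case: b.
have center_lt (b : bool) : (b + c.*2 < n.*2)%N.
  by case: b; rewrite ?ltn_Sdouble ?ltn_double.
have odd_center (b : bool) : odd (b + c.*2) = b.
  by rewrite oddD odd_double addbF; case: b.
move=> i lti; case: (ltngtP i./2 c) => [lt_ic|lt_ci|eq_ic].
- rewrite -(center (~~ odd i)); apply: edge_eq => //.
    rewrite -[X in (X < _)%N]odd_double_half.
    apply: (@leq_trans c.*2); last exact: leq_addl.
    by apply: leq_trans (_ : i./2.+1.*2 <= _)%N;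
      [case: (odd i) | rewrite leq_double].
  by rewrite /edge_tree odd_center half_bit_double; case: (odd i).
- rewrite -(center (odd i)); apply/esym/edge_eq => //.
    rewrite -[X in (_ < X)%N]odd_double_half.
    by rewrite ltn_add2l ltn_double.
  by rewrite /edge_tree odd_center half_bit_double eqxx.
by rewrite -(center (odd i)) -eq_ic odd_double_half.
Qed.

Lemma edge_tree_lt {n} (e : ordered_pair (2 * n)) :
  (edge_tree (val e).1 (val e).2 < n)%N.
Proof.
by rewrite /edge_tree; case: ifP => _; rewrite ltn_half_double -mul2n.
Qed.

(** * The determinant of a family of vectors on the edges *)

Section EdgeDeterminant.
Variables (k : fieldType) (V : vectType k).
Local Notation d := (dim V).
Local Notation edge := (ordered_pair (2 * d)).

Definition edge_of (i : 'I_(d * (2 * d - 1))) : edge :=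
  enum_val (cast_ord (esym (card_ordered_pair d)) i).

Definition edge_rank (e : edge) : 'I_(d * (2 * d - 1)) :=
  cast_ord (card_ordered_pair d) (enum_rank e).

Lemma edge_rankK : cancel edge_rank edge_of.
Proof. by move=> e; rewrite /edge_of cast_ordK enum_rankK. Qed.

Lemma edge_ofK : cancel edge_of edge_rank.
Proof. by move=> i; rewrite /edge_rank enum_valK cast_ordKV. Qed.

(** Zero at i = 2d - 1, the vertex whose equation is dropped. *)
Definition vertex_row (i : nat) : 'rV[k]_(2 * d - 1) := \row_r (r == i :> nat)%:R.

Definition edge_row (e : edge) (x : V) : 'rV[k]_(d * (2 * d - 1)) :=
  mxvec ((v2r x)^T *m (vertex_row (val e).1 - vertex_row (val e).2)).

Definition edge_det (v : edge -> V) : k :=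
  \det (\matrix_i edge_row (edge_of i) (v (edge_of i))).

Lemma edge_row_linear e : linear (edge_row e).
Proof. by move=> a x y; rewrite /edge_row !linearP /= mulmxDl -scalemxAl linearP. Qed.

Lemma edge_det_multilinear : multilinear (edge_det : (edge -> V) -> k^o).
Proof.
move=> v e a x y; rewrite /edge_det /=.
have upd z : update v e z (edge_of (edge_rank e)) = z.
  by rewrite edge_rankK /update eqxx.
have not_upd z i : update v e z (edge_of (lift (edge_rank e) i))
                   = v (edge_of (lift (edge_rank e) i)).
  rewrite /update ifN //; apply: contraNneq (neq_lift (edge_rank e) i).
  by move/(congr1 edge_rank); rewrite edge_ofK => ->.
rewrite -[X in _ = _ + X]mul1r.
apply: (@determinant_multilinear _ _ _ _ _ (edge_rank e)).
- by rewrite !rowK !upd edge_row_linear scale1r.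
- by apply/matrixP => i j; rewrite !mxE !not_upd.
by apply/matrixP => i j; rewrite !mxE !not_upd.
Qed.

(** The rows of the three edges of a triangle satisfy
    (p_x - p_y) - (p_x - p_z) + (p_y - p_z) = 0. *)
Lemma edge_det_triangle (v : edge -> V) (x y z : 'I_(2 * d))
    (hxy : (x < y)%N) (hxz : (x < z)%N) (hyz : (y < z)%N) :
    v (mk_pair hxy) = v (mk_pair hxz) -> v (mk_pair hxz) = v (mk_pair hyz) ->
  edge_det v = 0.
Proof.
move=> eq1 eq2; apply/eqP/det0P.
pose r e : 'rV[k]_(d * (2 * d - 1)) := delta_mx 0 (edge_rank e).
exists (r (mk_pair hxy) - r (mk_pair hxz) + r (mk_pair hyz)).
  apply/rV0Pn; exists (edge_rank (mk_pair hxy)).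
  rewrite !mxE eqxx !(can_eq edge_rankK) -!val_eqE /= !xpair_eqE !eqxx /=.
  by rewrite -!val_eqE /= (ltn_eqF hxy) (ltn_eqF hyz) subr0 addr0 oner_eq0.
rewrite mulmxDl mulmxBl -!rowE !rowK !edge_rankK /edge_row /=.
rewrite eq1 eq2 -linearB -linearD /= -mulmxBr -mulmxDr.
by rewrite opprB [X in X + _]addrC !subrKA subrr mulmx0 linear0.
Qed.

Definition tree_family (e : edge) : V :=
  r2v (delta_mx 0 (Ordinal (edge_tree_lt e))).

(** A vector w orthogonal to all rows is reshaped to a d by 2d - 1 matrix U,
    whose row c only meets the edges of tree c: there [tree_family] is the c-th
    basis vector. *)
Lemma edge_det_neq0 : edge_det tree_family != 0.
Proof.
rewrite /edge_det -det_tr; apply/det0P => -[w /eqP w_neq0 wM0]; apply: w_neq0.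
rewrite -[w]vec_mxK; set U := vec_mx w.
(* The potential of tree c: row c of U, extended by 0 to the last vertex. *)
pose g (c : 'I_d) (i : nat) : k := (row c U *m (vertex_row i)^T) 0 0.
have g_edge (c : 'I_d) i j :
    (i < j)%N -> (j < 2 * d)%N -> edge_tree i j = c -> g c i = g c j.
  move=> ltij ltj eqc.
  pose e : edge := @mk_pair (2 * d) (Ordinal (ltn_trans ltij ltj)) (Ordinal ltj) ltij.
  have tree_e : Ordinal (edge_tree_lt e) = c by apply: val_inj.
  have /matrixP/(_ 0 (edge_rank e)) := wM0.
  have -> : (w *m (\matrix_i edge_row (edge_of i) (tree_family (edge_of i)))^T)
              0 (edge_rank e) = (edge_row e (tree_family e) *m w^T) 0 0.
    rewrite !mxE; apply: eq_bigr => l _.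
    by rewrite !mxE edge_rankK mulrC.
  (* On flattened matrices, u^T *m q paired with U is u *m U *m q^T. *)
  rewrite -[w]vec_mxK /edge_row mxvec_dotmul /tree_family r2vK tree_e -rowE /=.
  rewrite linearB mulmxBr /= => /eqP.
  by rewrite !mxE subr_eq0 => /eqP; rewrite /g !mxE.
have g_last (c : 'I_d) : g c (2 * d - 1)%N = 0.
  rewrite /g !mxE big1 // => r _.
  by rewrite !mxE (ltn_eqF (ltn_ord r)) mulr0.
have g_ord (c : 'I_d) (r : 'I_(2 * d - 1)) : g c r = U c r.
  rewrite /g !mxE (bigD1 r) //= !mxE eqxx mulr1 big1 ?addr0 // => j neq_jr.
  by rewrite !mxE val_eqE (negPf neq_jr) mulr0.
suff -> : U = 0 by rewrite linear0.
apply/matrixP => c r; rewrite -g_ord [RHS]mxE -(g_last c).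
have gC := @double_star_connected _ _ _ _ (ltn_ord c) (g_edge c).
have lt_last : (2 * d - 1 < 2 * d)%N.
  by rewrite subn1 prednK // muln_gt0 /= (leq_ltn_trans _ (ltn_ord c)).
by rewrite (gC r) ?(gC (2 * d - 1)%N) // (ltn_trans (ltn_ord r)).
Qed.

End EdgeDeterminant.

Theorem corollary3p7 (k : fieldType) (d : nat) (hd : (2 <= d)%N)
    (V : vectType k) (hV : \dim {: V} = d) :
  exists detS2 : {linear tensor_power (ordered_pair (2 * d)) V -> k^o},
    (exists t, detS2 t <> 0) /\
    (forall v : ordered_pair (2 * d) -> V,
       (exists (x y z : 'I_(2 * d)) (hxy : (x < y)%N) (hyz : (y < z)%N),
          v (mk_pair hxy) = v (mk_pair (ltn_trans hxy hyz)) /\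
          v (mk_pair (ltn_trans hxy hyz)) = v (mk_pair hyz)) ->
       detS2 (tensor v) = 0).
Proof.
rewrite dimvf in hV; subst d; clear hd.
have [detS2 detS2E _] := tensor_universal (@edge_det_multilinear k V).
exists detS2; split=> [|v [x [y [z [hxy [hyz [eq1 eq2]]]]]]].
  by exists (tensor (@tree_family k V)); rewrite detS2E; apply/eqP/edge_det_neq0.
by rewrite detS2E; apply: edge_det_triangle eq1 eq2.
Qed.
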